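(* Let $(\Gamma,\sigma)$ be a finite graph embedded in a connected surface $\Sigma$ and let $e$ be an edge joining distinct vertices $v$ and $w$. Then $$\beta_{\Gamma}(x)=x\,\beta_{\Gamma/e}(x)+\beta_{\Gamma-v}(x)+\beta_{\Gamma-w}(x)-(1+x)\,\beta_{\Gamma-\{v,w\}}(x),$$ where $\Gamma/e$ carries the contracted embedding, and $\Gamma-v$, $\Gamma-w$, $\Gamma-\{v,w\}$ denote the induced subgraphs on the remaining vertices with restricted embeddings.
   Context: Graphs are finite and may have multiple edges and self-loops; a graph is viewed as a topological space. A subgraph is induced if it contains every edge of the ambient graph whose endpoints lie in its vertex set. For a connected subgraph $\Gamma'$, $f_\sigma(\Gamma')$ is the number of path components of $\Sigma\setminus\sigma(\Gamma')$; for a subgraph with components $\Gamma'_1,\dots,\Gamma'_k$, $f_\sigma(\Gamma')=\sum_j f_\sigma(\Gamma'_j)$, and $f_\sigma(\emptyset)=0$. If a graph $G$ has $m$ vertices, for $1\le i\le m-1$ put $\mathcal{D}_i(G,\sigma)=\sum f_\sigma(\Gamma')$ over all induced subgraphs $\Gamma'$ of $G$ with exactly $i$ vertices, and $\mathcal{D}_m(G,\sigma)=f_\sigma(G)$; $\beta_{(G,\sigma)}(x)=\sum_{i=1}^{m}\mathcal{D}_i(G,\sigma)x^{i-1}$, and the polynomial of the empty graph is $0$. Edge contraction: $\Gamma/e$ is obtained by deleting $e$ and identifying $v$ and $w$ to one new vertex (other edges between $v$ and $w$ become self-loops); its embedding is obtained by contracting $\sigma(e)$ to a point inside a small disc neighbourhood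 $U$ of $\sigma(e)$, modifying edges only inside $U$ and preserving cyclic orders, so it agrees with $\sigma$ outside $U$. *)

(* Defs.v *)
From HB Require Import structures.
From mathcomp Require Import all_boot all_order all_algebra finmap.
From mathcomp Require Import all_classical all_reals all_analysis.

Set Implicit Arguments.
Unset Strict Implicit.
Unset Printing Implicit Defensive.

Import Order.TTheory GRing.Theory Num.Theory.
Import numFieldNormedType.Exports.

Local Open Scope classical_set_scope.
Local Open Scope ring_scope.

Definition homeomorphic_sets (X Y : topologicalType) (A : set X) (B : set Y) :=
  exists (f : X -> Y) (g : Y -> X),
    [/\ {within A, continuous f}, {within B, continuous g},
        forall x, A x -> B (f x) /\ g (f x) = x
      & forall y, B y -> A (g y) /\ f (g y) = y].

(* f is a homeomorphism onto its image with the subspace topology. *)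
Definition topological_embedding (X Y : topologicalType) (f : X -> Y) :=
  injective f /\
  forall A : set X, open A <-> exists2 B : set Y, open B & A = f @^-1` B.

Definition path_within (R : realType) (X : topologicalType) (A : set X)
    (x y : X) :=
  exists p : R -> X, [/\ {within `[0, 1], continuous p},
    p 0 = x, p 1 = y & forall t : R, 0 <= t <= 1 -> A (p t)].

Definition path_components (R : realType) (X : topologicalType) (A : set X) :
    set (set X) :=
  [set path_within R A x | x in A].

(* When there are infinitely many path components this is 0.  The complement
   of a finite graph in a surface without boundary has finitely many. *)
Definition num_path_components (R : realType) (X : topologicalType)
    (A : set X) : nat :=
  #|` fset_set (path_components R A)|%fset.

Definition half_plane (R : realType) : set (R * R) := [set p | 0 <= p.2].

Definition unit_disc (R : realType) : set (R * R) :=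
  [set p | p.1 ^+ 2 + p.2 ^+ 2 <= 1].

(* Surfaces need not be compact and may have a boundary: a chart takes values
   in the closed half plane. *)
Definition surface (R : realType) (X : topologicalType) :=
  [/\ hausdorff_space X, @second_countable X
    & forall x : X, exists (W : set X) (V : set (R * R)),
        [/\ open W, W x, open V & homeomorphic_sets W (V `&` @half_plane R)]].

(* The orientation src -> tgt of an edge only serves to parametrize it. *)
Record mgraph := MGraph {
  vert : finType;
  edge : finType;
  src : edge -> vert;
  tgt : edge -> vert }.

Definition joins (G : mgraph) (e : edge G) (x y : vert G) : bool :=
  ((src e == x) && (tgt e == y)) || ((src e == y) && (tgt e == x)).

Section Induced.
Variables (G : mgraph) (S : {set vert G}).

Definition induced_vert := {x : vert G | x \in S}.
Definition induced_edge := {f : edge G | (src f \in S) && (tgt f \in S)}.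

Lemma induced_src_subproof (f : induced_edge) : src (val f) \in S.
Proof. by case: f => f /= /andP[]. Qed.

Lemma induced_tgt_subproof (f : induced_edge) : tgt (val f) \in S.
Proof. by case: f => f /= /andP[]. Qed.

Definition induced_graph : mgraph := {|
  vert := induced_vert;
  edge := induced_edge;
  src := fun f => Sub (src (val f)) (induced_src_subproof f);
  tgt := fun f => Sub (tgt (val f)) (induced_tgt_subproof f) |}.

Definition adj_in : rel (vert G) :=
  [rel x y | [&& x \in S, y \in S & [exists f : edge G, joins f x y]]].

(* The vertex sets of the connected components of the induced subgraph on S;
   these components are again induced subgraphs of G. *)
Definition components : {set {set vert G}} :=
  equivalence_partition (connect adj_in) S.

End Induced.

Section Contract.
Variables (G : mgraph) (e : edge G).

Definition ends : {set vert G} := [set src e; tgt e]%SET.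

(* None is the vertex obtained by identifying the ends of e. *)
Definition contract_vert := option {x : vert G | x \notin ends}.
Definition contract_edge := {f : edge G | f != e}.

Definition merge (x : vert G) : contract_vert := insub x.

Definition contract_graph : mgraph := {|
  vert := contract_vert;
  edge := contract_edge;
  src := fun f => merge (src (val f));
  tgt := fun f => merge (tgt (val f)) |}.

End Contract.

(* A point is a vertex or a point of an open edge. *)
Definition realization (R : realType) (G : mgraph) : Type :=
  (vert G + edge G * {t : R | 0 < t < 1})%type.

HB.instance Definition _ (R : realType) (G : mgraph) :=
  Choice.copy (realization R G)
    (vert G + edge G * {t : R | 0 < t < 1})%type.

(* The characteristic map [0, 1] -> |G| of an edge, extended to R by the
   retraction of R onto [0, 1]. *)
Definition char_map (R : realType) (G : mgraph) (e : edge G) (t : R) :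
    realization R G :=
  if insub t is Some u then inr (e, u)
  else if t <= 0 then inl (src e) else inl (tgt e).

(* The quotient topology of V + E * [0, 1].  Since R retracts onto [0, 1], a
   subset of [0, 1] is relatively open iff its preimage under the retraction
   is open in R. *)
Definition realization_open (R : realType) (G : mgraph) :
    set_system (realization R G) :=
  [set A | forall e : edge G, open (@char_map R G e @^-1` A)].

Section RealizationTopology.
Variables (R : realType) (G : mgraph).

Lemma realization_openT : @realization_open R G setT.
Proof. by move=> e; rewrite preimage_setT; exact: openT. Qed.

Lemma realization_openI : setI_closed (@realization_open R G).
Proof. by move=> A B oA oB e; rewrite preimage_setI; exact: openI. Qed.

Lemma realization_open_bigU (I : Type) (f : I -> set (realization R G)) :
  (forall i, realization_open (f i)) -> realization_open (\bigcup_i f i).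
Proof.
move=> of_ e; rewrite preimage_bigcup.
by apply: bigcup_open => i _; exact: of_.
Qed.

HB.instance Definition _ := isOpenTopological.Build (realization R G)
  realization_openT realization_openI realization_open_bigU.

End RealizationTopology.

(* The induced subgraph on S, as a subspace of |G|. *)
Definition subspace_of (R : realType) (G : mgraph) (S : {set vert G}) :
    set (realization R G) :=
  [set z | match z with
           | inl x => x \in S
           | inr (f, _) => (src f \in S) && (tgt f \in S)
           end].

Definition closed_edge (R : realType) (G : mgraph) (e : edge G) :
    set (realization R G) :=
  @char_map R G e @` `[0, 1].

Definition induced_incl (R : realType) (G : mgraph) (S : {set vert G})
    (z : realization R (induced_graph S)) : realization R G :=
  match z with
  | inl x => inl (val x)
  | inr (f, t) => inr (val f, t)
  end.

(* The quotient map |G| -> |G / e| collapsing the closed edge e. *)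
Definition collapse (R : realType) (G : mgraph) (e : edge G)
    (z : realization R G) : realization R (contract_graph e) :=
  match z with
  | inl x => inl (merge e x)
  | inr (f, t) => if insub f is Some f' then inr (f', t) else inl None
  end.

Section EmbeddedGraph.
Variables (R : realType) (Sigma : topologicalType).

Definition restrict_embedding (G : mgraph) (sigma : realization R G -> Sigma)
    (S : {set vert G}) : realization R (induced_graph S) -> Sigma :=
  sigma \o @induced_incl R G S.

(* f_sigma of the induced subgraph on S. *)
Definition face_number (G : mgraph) (sigma : realization R G -> Sigma)
    (S : {set vert G}) : nat :=
  (\sum_(C in components S)
     num_path_components R (~` (sigma @` @subspace_of R G C)))%N.

(* For i = #|vert G| the only summand is f_sigma of G itself. *)
Definition face_sum (G : mgraph) (sigma : realization R G -> Sigma) (i : nat) :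
    nat :=
  (\sum_(S : {set vert G} | #|S| == i) face_number sigma S)%N.

Definition beta (G : mgraph) (sigma : realization R G -> Sigma) : {poly int} :=
  \sum_(1 <= i < #|vert G|.+1) (face_sum sigma i)%:R *: 'X^(i.-1).

(* sigma' is obtained from sigma by contracting sigma(e) to a point inside the
   disc neighbourhood U of sigma(e), which is small enough to avoid the rest of
   the graph, namely the part that is not incident to e.  The contraction is
   carried out by a map h of Sigma that is the identity outside U, maps U onto
   itself, and collapses sigma(e) without any other identification; sigma' is
   then the factorization of h \o sigma through |G / e|.  In particular sigma'
   agrees with sigma outside U, and the cyclic orders are preserved because h is
   a homeomorphism off sigma(e) that fixes the complement of U. *)
Definition contracted_embedding (G : mgraph) (sigma : realization R G -> Sigma)
    (e : edge G) (sigma' : realization R (contract_graph e) -> Sigma) :=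
  exists (U : set Sigma) (h : Sigma -> Sigma),
    [/\ homeomorphic_sets (@unit_disc R) U,
        sigma @` @closed_edge R G e `<=` U°,
        U `&` sigma @` @subspace_of R G (~: ends e)%SET = set0,
        [/\ continuous h,
            forall x, ~ U x -> h x = x,
            h @` U = U
          & forall x y, h x = h y <->
              x = y \/ ((sigma @` @closed_edge R G e) x /\
                        (sigma @` @closed_edge R G e) y)]
      & forall z, sigma' (collapse e z) = h (sigma z)].

End EmbeddedGraph.

Arguments restrict_embedding {R Sigma G} sigma S _.

(* Main.v *)
Require Import Defs.
From HB Require Import structures.
From mathcomp Require Import all_boot all_order all_algebra ring.
From mathcomp Require Import all_classical all_reals all_analysis.

(* All vertex sets S contribute f(S) x^(|S| - 1) to the polynomial; those that
   miss v or w are accounted for by inclusion-exclusion, and those that contain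
   both v and w correspond to the vertex sets of G / e that contain the merged
   vertex, with one vertex less.  The face numbers agree under this
   correspondence, component by component.  A component through e has the same
   faces before and after the contraction because the contracting map h, being
   the identity off a compact disc, is a closed map, hence a homeomorphism from
   the complement of sigma(e) onto the complement of a point.  A component that
   avoids the ends of e lies outside the disc and is not moved. *)

Set Implicit Arguments.
Unset Strict Implicit.
Unset Printing Implicit Defensive.

Import Order.TTheory GRing.Theory Num.Theory.
Import numFieldNormedType.Exports.

Local Open Scope classical_set_scope.
Local Open Scope ring_scope.

(** * Path components under homeomorphism *)

Lemma within_comp_continuous (X Y Z : topologicalType) (A : set X) (B : set Y)
    (f : X -> Y) (g : Y -> Z) :
  {within A, continuous f} -> {within B, continuous g} ->
  (forall x, A x -> B (f x)) -> {within A, continuous (g \o f)}.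
Proof.
move=> /subspace_continuousP cf /subspace_continuousP cg AB.
apply/subspace_continuousP => x Ax.
apply: cvg_trans (cg _ (AB _ Ax)).
move=> W /= /(cf _ Ax); rewrite /= /nbhs /= /within /= => H.
by apply: filterS H => y /= H Ay; apply: H => //; exact: AB.
Qed.

Lemma path_within_homeo (R : realType) (X Y : topologicalType) (A : set X)
    (B : set Y) (f : X -> Y) x y :
  {within A, continuous f} -> (forall z, A z -> B (f z)) ->
  path_within R A x y -> path_within R B (f x) (f y).
Proof.
move=> cf AB [p [cp p0 p1 pA]]; exists (f \o p); split => /=.
- apply: (within_comp_continuous cp cf) => t /=.
  by rewrite in_itv /= => /pA.
- by rewrite p0.
- by rewrite p1.
- by move=> t /pA/AB.
Qed.

Lemma path_within_target (R : realType) (X : topologicalType) (A : set X) x y :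
  path_within R A x y -> A y.
Proof. by move=> [p [_ _ <- pA]]; apply: pA; rewrite ler01 lexx. Qed.

(** Taking images under [f] is a bijection between the two sets of path components: the image of the
    component of [x] is that of [f x], and [g] recovers a component from its image. *)
Lemma homeomorphic_num_path_components (R : realType) (X Y : topologicalType)
    (A : set X) (B : set Y) :
  homeomorphic_sets A B -> num_path_components R A = num_path_components R B.
Proof.
move=> [f [g [cf cg fA gB]]].
have AB z : A z -> B (f z) by move=> /fA[].
have BA z : B z -> A (g z) by move=> /gB[].
have imP x : A x -> f @` path_within R A x = path_within R B (f x).
  move=> Ax; apply/seteqP; split => [_ [y xy <-]|y xy].
    exact: path_within_homeo xy.
  have [_ fgy] := gB _ (path_within_target xy).
  exists (g y) => //; have [_ {1}<-] := fA _ Ax.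
  exact: path_within_homeo xy.
have imE : path_components R B = image^~ f @` path_components R A.
  apply/seteqP; split => [_ [y By <-]|_ [_ [x Ax <-] <-]].
    have [Agy fgy] := gB _ By.
    by exists (path_within R A (g y)); [exists (g y)|rewrite imP ?fgy].
  by rewrite imP//; exists (f x) => //; exact: AB.
have : (path_components R B #= path_components R A)%card.
  rewrite imE; apply: inj_card_eq => _ _ /set_mem[x Ax <-] /set_mem[y Ay <-].
  have sub a b : A a -> f @` path_within R A a `<=` f @` path_within R A b ->
      path_within R A a `<=` path_within R A b.
    move=> Aa H z az; have [t bt ft] := H _ (imageP f az).
    have [_ <-] := fA _ (path_within_target az).
    by rewrite -ft; have [_ ->] := fA _ (path_within_target bt).
  by move=> E; apply/seteqP; split; apply: sub => //; rewrite E.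
move=> E; rewrite /num_path_components.
(* Equipotence also transfers infiniteness, and then both counts take the default value 0. *)
have [finA|infA] := pselect (finite_set (path_components R A)).
  by apply/esym/fcard_eq; rewrite ?(eq_finite_set E).
rewrite /fset_set; case: pselect => // _.
by rewrite -(eq_finite_set E) in infA; case: pselect.
Qed.

(** * Topology of the contracting map *)

Lemma compact_unit_disc (R : realType) : compact (@unit_disc R).
Proof.
have cI : compact (`[-1, 1]%classic `*` `[-1, 1]%classic : set (R * R)).
  by apply: compact_setX; exact: segment_compact.
apply: (subclosed_compact _ cI).
- have -> : @unit_disc R =
      (fun p : R * R => p.1 ^+ 2 + p.2 ^+ 2) @^-1` [set x | x <= 1] by [].
  apply: closed_comp; last exact: closed_le.
  move=> p _; apply: cvgD.
    by rewrite expr2; apply: cvgM; exact: cvg_fst.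
  by rewrite expr2; apply: cvgM; exact: cvg_snd.
- have sqr_le1_itv (z : R) : z ^+ 2 <= 1 -> -1 <= z <= 1.
    by rewrite -ler_norml -[z ^+ 2]real_normK ?num_real // expr_le1.
  move=> [x y]; rewrite /unit_disc /= !in_itv /= => xy1.
  by split; apply: sqr_le1_itv; apply: le_trans xy1;
    rewrite ?lerDl ?lerDr sqr_ge0.
Qed.

(** The image of [F] splits into the image of the compact part inside [U] and the fixed points of
    [h] in [F]; both pieces are closed in a Hausdorff space. *)
Lemma closed_image_supported (X : topologicalType) (U F : set X) (h : X -> X) :
  hausdorff_space X -> compact U -> continuous h ->
  (forall x, ~ U x -> h x = x) -> closed F -> closed (h @` F).
Proof.
move=> hX cU ch hid clF.
have -> : h @` F = h @` (F `&` U) `|` (F `&` [set x | h x = x]).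
  apply/seteqP; split => [_ [x Fx <-]|z [[x [Fx _] <-]|[Fz hz]]].
  - have [Ux|nUx] := pselect (U x); first by left; exists x.
    by right; rewrite /= !hid.
  - by exists x.
  - by exists z.
apply: closedU.
  apply: compact_closed => //; apply: continuous_compact.
    exact: continuous_subspaceT.
  rewrite setIC; apply: (subclosed_compact _ cU) => //.
  by apply: closedI => //; exact: compact_closed.
(* If [x] is a limit of fixed points, any neighbourhoods of [h x] and of [x] share a fixed point, so
   the Hausdorff property gives [h x = x]. *)
apply: closedI => // x clx; apply: hX => A B hA xB.
have [y [/= hy [Ay By]]] :=
  clx _ (@filterI _ _ (nbhs_filter x) _ _ (ch x _ hA) xB).
by exists y; split => //; rewrite -hy.
Qed.

(* The inverse is continuous because [h] is a closed map. *)
Lemma collapse_homeo_complement (X : topologicalType) (U K A : set X)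
    (h : X -> X) :
  hausdorff_space X -> compact U -> continuous h ->
  (forall x, ~ U x -> h x = x) -> h @` U = U ->
  (forall x y, h x = h y -> x = y \/ K x /\ K y) -> K `<=` A ->
  homeomorphic_sets (~` A) (~` (h @` A)).
Proof.
move=> hX cU ch hid hU hK KA.
(* [h] is onto, being the identity off [U] and mapping [U] onto itself. Any section [g] will do: off
   the image of [A] preimages are unique. *)
have /choice[g gK] : forall y, exists x, h x = y.
  move=> y; have [Uy|nUy] := pselect (U y); last by exists y; exact: hid.
  by move: Uy; rewrite -{1}hU => -[x _ <-]; exists x.
exists h, g; split.
- exact: continuous_subspaceT.
- apply/subspace_continuousP => y nAy W /=.
  rewrite nbhsE => -[V [oV Vy] VW].
  rewrite /nbhs /= /within /=.
  have clhV : closed (h @` (~` V)).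
    by apply: (closed_image_supported hX cU) => //; exact: open_closedC.
  (* This open set contains [y] because [h] identifies points only inside [A]; any [z] in it has
     [g z] in [V], since [h (g z) = z]. *)
  have : nbhs y (~` (h @` (~` V))).
    apply: open_nbhs_nbhs; split; first exact: closed_openC.
    move=> [x nVx hxy]; have [|xg|[_ Kgy]] := hK x (g y); first by rewrite gK.
      by apply: nVx; rewrite xg.
    by apply: nAy; exists (g y) => //; exact: KA.
  apply: filterS => z nz _; apply: VW; apply: contrapT => nVz.
  by apply: nz; exists (g z).
- move=> x nAx; split.
    move=> [a Aa /hK[ax|[_ /KA]]] //.
    by apply: nAx; rewrite -ax.
  by have [|//|[_ /KA]] := hK (g (h x)) x; rewrite ?gK.
- move=> y nhAy; split; last exact: gK.
  by move=> Agy; apply: nhAy; exists (g y).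
Qed.

(** * Connected components under a map of vertices *)

(** A path of [r'] lifts one edge at a time, staying in [D]. The lift may end at another point of
    the fibre of [phi y] than [y]; connectedness of fibres closes this gap. *)
Lemma connect_preimage (T T' : finType) (phi : T -> T') (r : rel T)
    (r' : rel T') (D : {pred T}) :
  (forall x y, r x y -> connect r' (phi x) (phi y)) ->
  (forall x b, x \in D -> r' (phi x) b ->
     exists y, [/\ y \in D, phi y = b & connect r x y]) ->
  {in D, forall x y, phi x = phi y -> connect r x y} ->
  {in D, forall x y, connect r x y = connect r' (phi x) (phi y)}.
Proof.
move=> r_r' r'_r fib x Dx y; apply/idP/idP.
  move=> /connectP[p]; elim: p x {Dx} => [|z p IHp] x /=.
    by move=> _ ->; exact: connect0.
  by move=> /andP[/r_r' xz /IHp zy] /zy; exact: connect_trans xz.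
move=> /connectP[p]; elim: p x Dx => [|b p IHp] x Dx /=.
  by move=> _ /esym; exact: fib.
move=> /andP[/(r'_r _ _ Dx)[z [Dz <- xz]] pb] yE.
exact: connect_trans xz (IHp _ Dz pb yE).
Qed.

Lemma components_sub (G : mgraph) (S C : {set vert G}) :
  C \in components S -> C \subset S.
Proof.
by move=> /imsetP[x _ ->]; apply/fintype.subsetP => y; rewrite inE => /andP[].
Qed.

Section FaceNumberPreimage.
Variables (R : realType) (Sigma : topologicalType) (G G' : mgraph).
Variables (phi : vert G -> vert G') (S' : {set vert G'}).
Let S : {set vert G} := (phi @^-1: S')%SET.

Hypothesis phi_surj : forall a, a \in S' -> exists x, phi x = a.
Hypothesis phi_joins : forall f x y, joins f x y ->
  phi x = phi y \/ exists f', joins f' (phi x) (phi y).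
Hypothesis joins_phi : forall f' a b,
  a \in S' -> b \in S' -> joins f' a b ->
  exists f x y, [/\ phi x = a, phi y = b & joins f x y].
Hypothesis phi_fiber :
  {in S, forall x y, phi x = phi y -> connect (adj_in S) x y}.

Lemma connect_adj_preimage : {in S, forall x y,
  connect (adj_in S) x y = connect (adj_in S') (phi x) (phi y)}.
Proof.
apply: connect_preimage => // [x y /and3P[]|x b Sx /and3P[]].
  rewrite !inE => Sx Sy /existsP[f /phi_joins[-> //|[f' j]]].
  by apply: connect1; rewrite /adj_in /= Sx Sy; apply/existsP; exists f'.
move=> S'x S'b /existsP[f' /(joins_phi S'x S'b)[f [z [y [zx yb j]]]]].
have Sy : y \in S by rewrite inE yb.
have Sz : z \in S by rewrite inE zx.
(* The lifted edge may start at another point [z] over [phi x], hence a detour inside the fibre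
   first. *)
exists y; split => //; apply: connect_trans (phi_fiber Sx (esym zx)) _.
by apply: connect1; rewrite /adj_in /= Sz Sy; apply/existsP; exists f.
Qed.

Lemma components_preimage :
  components S = [set phi @^-1: C | C : {set vert G'} in components S']%SET.
Proof.
have preE x : x \in S ->
    [set y in S | connect (adj_in S) x y]%SET =
    (phi @^-1: [set b in S' | connect (adj_in S') (phi x) b])%SET.
  by move=> Sx; apply/setP => y; rewrite !inE connect_adj_preimage.
rewrite /components /equivalence_partition -imset_comp.
apply/setP => C; apply/imsetP/imsetP => [[x Sx ->]|[a S'a ->]].
  by exists (phi x); [rewrite inE in Sx|rewrite preE].
have [x xa] := phi_surj S'a; have Sx : x \in S by rewrite inE xa.
by exists x => //; rewrite preE //= xa.
Qed.

(** Used with [phi] the inclusion of an induced subgraph and with [phi] the merging of the ends of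
    an edge. Distinct components of [S'] have distinct preimages because [phi] is onto [S'], so the
    sum over components can be reindexed. *)
Lemma face_number_preimage (sigma : realization R G -> Sigma)
    (sigma' : realization R G' -> Sigma) :
  (forall C, C \in components S' ->
    num_path_components R (~` (sigma @` subspace_of (phi @^-1: C)%SET)) =
    num_path_components R (~` (sigma' @` subspace_of C))) ->
  face_number sigma S = face_number sigma' S'.
Proof.
move=> npcE; rewrite /face_number components_preimage big_imset.
  by apply: eq_bigr => C /npcE.
move=> C D /components_sub CS /components_sub DS E.
have imK (B : {set vert G'}) : B \subset S' -> (phi @: (phi @^-1: B) = B)%SET.
  move=> BS; apply/setP => b; apply/imsetP/idP => [[x]|Bb].
    by rewrite inE => Bx ->.
  have [x xb] := phi_surj (fintype.subsetP BS _ Bb).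
  by exists x => //; rewrite inE xb.
by rewrite -(imK C) // E imK.
Qed.

End FaceNumberPreimage.

(** * Face numbers of induced and contracted graphs *)

Section FaceNumbers.
Variables (R : realType) (Sigma : topologicalType).

(** Here [phi] is [val], and [T] is the preimage of its own image. Every component of that image
    lies in [S0], so its realization is the image of its copy in the induced subgraph. *)
Lemma face_number_restrict (G : mgraph) (sigma : realization R G -> Sigma)
    (S0 : {set vert G}) (T : {set vert (induced_graph S0)}) :
  face_number (restrict_embedding sigma S0) T =
  face_number sigma (val @: T)%SET.
Proof.
have TE : (T = val @^-1: (val @: T))%SET.
  by apply/setP => x; rewrite inE mem_imset //; exact: val_inj.
have TS (x : vert G) : x \in (val @: T)%SET -> x \in S0.
  by move=> /imsetP[y _ ->]; exact: valP.
rewrite {1}TE; apply: face_number_preimage.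
- by move=> a /imsetP[x _ ->]; exists x.
- move=> f x y j; right; exists (val f).
  by move: j; rewrite /joins /= -!val_eqE.
- move=> f a b /TS Sa /TS Sb j.
  have Sf : (src f \in S0) && (tgt f \in S0).
    by case/orP: j => /andP[/eqP-> /eqP->]; rewrite ?Sa ?Sb.
  exists (exist _ f Sf), (exist _ a Sa), (exist _ b Sb).
  by split.
- by move=> x _ y /val_inj ->; exact: connect0.
move=> C /components_sub/fintype.subsetP CT; congr (num_path_components R (~` _)).
rewrite /restrict_embedding -image_comp; congr (_ @` _).
apply/seteqP; split => [_ [[x|[f t]] /= + <-]|[x|[f t]]] /=; rewrite ?inE //=.
  by move=> Cx; exists (inl (exist _ x (TS _ (CT _ Cx)))); rewrite /= ?inE.
move=> /[dup] /andP[/CT/TS Ss /CT/TS St] Cf.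
have Sf : (src f \in S0) && (tgt f \in S0) by rewrite Ss St.
by exists (inr (exist _ f Sf, t)); rewrite /= ?inE.
Qed.

Lemma merge_ends (G : mgraph) (e : edge G) (x : vert G) :
  (Defs.merge e x == None) = (x \in ends e).
Proof.
by rewrite /Defs.merge; case: insubP => [u /negPf -> _|]; rewrite ?negbK.
Qed.

Lemma merge_inj (G : mgraph) (e : edge G) (x y : vert G) :
  Defs.merge e x = Defs.merge e y -> x = y \/ x \in ends e /\ y \in ends e.
Proof.
have [xe|xe] := boolP (x \in ends e).
  have /eqP -> : Defs.merge e x == None by rewrite merge_ends.
  by move/esym/eqP; rewrite merge_ends; right.
rewrite /Defs.merge; case: insubP => [u _ <-|]; last by rewrite xe.
by case: insubP => // w _ <- [->]; left.
Qed.

Lemma merge_surj (G : mgraph) (e : edge G) (a : contract_vert e) :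
  exists x, Defs.merge e x = a.
Proof.
case: a => [u|]; first by exists (val u); rewrite /Defs.merge valK.
by exists (src e); apply/eqP; rewrite merge_ends !inE eqxx.
Qed.

Lemma collapse_surj (G : mgraph) (e : edge G)
    (z : realization R (contract_graph e)) : exists y, collapse e y = z.
Proof.
case: z => [a|[f t]]; last by exists (inr (val f, t)); rewrite /= valK.
by have [x <-] := merge_surj a; exists (inl x).
Qed.

(** Only the open edge [e] needs care: it collapses to [None], and both its ends merge to [None], so
    either side contains it exactly when [C] contains [None]. *)
Lemma collapse_subspace_of (G : mgraph) (e : edge G)
    (C : {set vert (contract_graph e)}) :
  @collapse R G e @^-1` subspace_of C = subspace_of (Defs.merge e @^-1: C)%SET.
Proof.
apply/seteqP; split => -[x|[f t]] /=; rewrite ?inE //;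
  case: insubP => [f' _ <- //|]; rewrite negbK => /eqP ->.
  have /eqP -> : Defs.merge e (src e) == None by rewrite merge_ends !inE eqxx.
  have /eqP -> : Defs.merge e (tgt e) == None.
    by rewrite merge_ends !inE eqxx orbT.
  by move=> ->.
have /eqP -> : Defs.merge e (src e) == None by rewrite merge_ends !inE eqxx.
by move=> /andP[].
Qed.

Lemma face_number_contract (G : mgraph) (sigma : realization R G -> Sigma)
    (e : edge G) (sigma' : realization R (contract_graph e) -> Sigma)
    (S : {set vert (contract_graph e)}) :
  hausdorff_space Sigma -> contracted_embedding sigma sigma' ->
  face_number sigma (Defs.merge e @^-1: S)%SET = face_number sigma' S.
Proof.
move=> hS [U [h [discU _ U0 [ch hid hU hK] hsigma]]].
apply: face_number_preimage.
- by move=> a _; exact: merge_surj.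
- move=> f x y j; have [fe|fe] := eqVneq f e.
    left; rewrite fe in j.
    have [xe ye] : x \in ends e /\ y \in ends e.
      by case/orP: j => /andP[/eqP<- /eqP<-]; rewrite !inE !eqxx ?orbT.
    by move: xe ye; rewrite -!merge_ends => /eqP -> /eqP ->.
  right; exists (exist _ f fe : edge (contract_graph e)).
  by case/orP: j => /andP[/eqP<- /eqP<-]; rewrite /joins /= !eqxx ?orbT.
- move=> f' a b _ _ j; exists (val f').
  case/orP: j => /andP[/eqP<- /eqP<-].
    by exists (src (val f')), (tgt (val f')); rewrite /joins !eqxx.
  by exists (tgt (val f')), (src (val f')); rewrite /joins !eqxx orbT.
(* The only fibre with more than one point consists of the ends of [e], which [e] itself joins. *)
- move=> x Sx y xy; have [-> //|[xe ye]] := merge_inj xy.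
  have Sy : y \in (Defs.merge e @^-1: S)%SET by move: Sx; rewrite !inE xy.
  have [->|xy'] := eqVneq x y; first exact: connect0.
  apply: connect1; rewrite /adj_in /= Sx Sy; apply/existsP; exists e.
  move: xe ye xy'; rewrite !inE /joins.
  by move=> /orP[]/eqP-> /orP[]/eqP->; rewrite !eqxx ?orbT.
move=> C _; rewrite -collapse_subspace_of.
(* Since [collapse] is onto, the relation between [sigma'] and [h] determines the whole image of
   [sigma']. *)
have -> : sigma' @` subspace_of C =
    h @` (sigma @` (@collapse R G e @^-1` subspace_of C)).
  rewrite image_comp; apply/seteqP; split => [_ [z Cz <-]|_ [z Cz <-]].
    have [y yz] := collapse_surj z.
    by exists y; rewrite /= -?hsigma yz.
  by exists (collapse e z).
have cU : compact U.
  have [f [g [cf _ fU gU]]] := discU.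
  have -> : U = f @` @unit_disc R.
    apply/seteqP; split => [y /gU[? ?]|_ [x /fU[? _] <-] //].
    by exists (g y).
  by apply: continuous_compact => //; exact: compact_unit_disc.
(* A component through the merged vertex pulls back to one containing the closed edge, so the image
   of that edge can serve as the collapsed set [K]. *)
have [CN|CN] := boolP (None \in C).
  apply: homeomorphic_num_path_components.
  apply: (collapse_homeo_complement hS cU ch hid hU).
    by move=> x y /hK; exact.
  rewrite collapse_subspace_of.
  apply: image_subset => _ [t _ <-].
  have sC : src e \in (Defs.merge e @^-1: C)%SET.
    rewrite inE; have /eqP -> // : Defs.merge e (src e) == None.
    by rewrite merge_ends !inE eqxx.
  have tC : tgt e \in (Defs.merge e @^-1: C)%SET.
    rewrite inE; have /eqP -> // : Defs.merge e (tgt e) == None.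
    by rewrite merge_ends !inE eqxx orbT.
  rewrite /char_map; case: insubP => [u _ _|_] /=; first by rewrite sC.
  by case: ifP.
(* Otherwise the preimage avoids both ends of [e]; by [U0] its image misses [U], where alone [h] can
   move points. *)
congr (num_path_components R (~` _)).
rewrite -[LHS]image_id; apply: eq_imagel => _ [z Cz <-].
apply/esym/hid => Uz.
suff : set0 (sigma z) by [].
rewrite -U0; split => //; exists z => //.
move: Cz; rewrite collapse_subspace_of.
have H x : x \in (Defs.merge e @^-1: C)%SET -> x \in (~: ends e)%SET.
  by rewrite finset.in_setC -merge_ends inE; apply: contraL => /eqP ->.
by case: z {Uz} => [x|[f t]] /=; [exact: H|move=> /andP[/H -> /H]].
Qed.

(** * The polynomial as a sum over vertex sets *)

Lemma face_number0 (G : mgraph) (sigma : realization R G -> Sigma) :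
  face_number sigma finset.set0 = 0%N.
Proof.
rewrite /face_number big1 // => C.
by rewrite /components /equivalence_partition imset0 inE.
Qed.

Lemma betaE (G : mgraph) (sigma : realization R G -> Sigma) :
  beta sigma =
    \sum_(S : {set vert G}) (face_number sigma S)%:R *: 'X^(#|S|.-1).
Proof.
rewrite [RHS](partition_big
  (fun S : {set vert G} => inord #|S| : 'I_#|vert G|.+1) predT) //=.
have inordE (S : {set vert G}) (i : 'I_#|vert G|.+1) :
    (inord #|S| == i) = (#|S| == i :> nat).
  by rewrite -val_eqE /= inordK // ltnS max_card.
under eq_bigr => i _ do under eq_bigl => S do rewrite inordE.
rewrite /beta -(big_mkord predT (fun i : nat =>
  \sum_(S : {set vert G} | #|S| == i) (face_number sigma S)%:R *: 'X^(#|S|.-1))).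
(* The sum in [beta] starts at 1, so the term of the empty set is split off. *)
rewrite [RHS]big_ltn // [X in _ = X + _]big1 ?add0r; last first.
  by move=> S; rewrite cards_eq0 => /eqP ->; rewrite face_number0 scale0r.
apply: eq_bigr => i _; rewrite /face_sum natr_sum scaler_suml.
by apply: eq_bigr => S /eqP ->.
Qed.

Lemma beta_restrict (G : mgraph) (sigma : realization R G -> Sigma)
    (S0 : {set vert G}) :
  beta (restrict_embedding sigma S0) =
    \sum_(S : {set vert G} | S \subset S0)
      (face_number sigma S)%:R *: 'X^(#|S|.-1).
Proof.
rewrite betaE.
rewrite (reindex_onto (fun T : {set vert (induced_graph S0)} => val @: T)%SET
  (fun S => val @^-1: S)%SET); last first.
  move=> S /fintype.subsetP SS; apply/setP => x; apply/imsetP/idP => [[y]|Sx].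
    by rewrite inE => Sy ->.
  by exists (exist _ x (SS _ Sx)); rewrite ?inE.
apply: eq_big => [T|T _].
  apply/esym/andP; split.
    by apply/fintype.subsetP => _ /imsetP[x _ ->]; exact: valP.
  by apply/eqP/setP => x; rewrite inE mem_imset //; exact: val_inj.
by rewrite face_number_restrict card_imset //; exact: val_inj.
Qed.

(** Away from [None] merging is a bijection, while the fibre over [None] has the two ends of [e]:
    one extra element exactly when [None] is in [S]. *)
Lemma card_merge_preimage (G : mgraph) (e : edge G)
    (S : {set vert (contract_graph e)}) :
  src e != tgt e ->
  #|(Defs.merge e @^-1: S)%SET| = (#|S| + (None \in S))%N.
Proof.
move=> ne.
have DE :
    (Defs.merge e @^-1: (S :\ None) = (Defs.merge e @^-1: S) :\: ends e)%SET.
  by apply/setP => x; rewrite finset.in_setD -merge_ends !inE.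
have cD : #|(Defs.merge e @^-1: (S :\ None))%SET| = #|(S :\ None)%SET|.
  rewrite -(card_in_imset (f := Defs.merge e)); last first.
    move=> x y; rewrite DE => /setDP[_ xe] _ /merge_inj[//|[]].
    by rewrite (negPf xe).
  congr #|pred_of_set _|; apply/setP => b; apply/imsetP/idP => [[x]|Sb].
    by rewrite inE => Sx ->.
  by have [x xb] := merge_surj b; exists x; rewrite ?inE xb // -in_setD1.
rewrite (cardsD1 None S) -cD DE -(cardsID (ends e)) addnC.
have [NS|NS] := boolP (None \in S).
  have -> : (Defs.merge e @^-1: S :&: ends e = ends e)%SET.
    apply/finset.setIidPr/fintype.subsetP => x; rewrite -merge_ends inE.
    by move=> /eqP ->.
  by rewrite cards2 ne addnS addn1 addn1 add1n.
have -> : (Defs.merge e @^-1: S :&: ends e = finset.set0)%SET.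
  apply/setP => x; rewrite finset.in_setI -merge_ends !inE.
  by apply/negP => /andP[+ /eqP xN]; rewrite xN (negPf NS).
by rewrite cards0 !addn0.
Qed.

Lemma joins_ends (G : mgraph) (e : edge G) v w :
  joins e v w -> ends e = [set v; w]%SET.
Proof.
by case/orP => /andP[/eqP<- /eqP<-] //; rewrite /ends finset.setUC.
Qed.

(** The vertex sets containing both or neither of [v] and [w] are the unions of fibres of [merge e],
    so preimage and image are inverse to each other on them. The boolean [b] treats the two cases at
    once. *)
Lemma big_merge_preimage (V : nmodType) (G : mgraph) (e : edge G)
    (v w : vert G) (b : bool) (F : {set vert G} -> V) :
  joins e v w ->
  \sum_(S : {set vert (contract_graph e)} | (None \in S) == b)
    F (Defs.merge e @^-1: S)%SET =
  \sum_(S : {set vert G} | ((v \in S) == b) && ((w \in S) == b)) F S.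
Proof.
move=> /joins_ends endsE.
have mergeN x : x \in ends e -> Defs.merge e x = None.
  by rewrite -merge_ends => /eqP.
have mv : Defs.merge e v = None by apply: mergeN; rewrite endsE !inE eqxx.
have mw : Defs.merge e w = None by apply: mergeN; rewrite endsE !inE eqxx orbT.
rewrite [RHS](reindex_onto
  (fun S : {set vert (contract_graph e)} => Defs.merge e @^-1: S)%SET
  (fun S => Defs.merge e @: S)%SET) /=; last first.
  move=> S /andP[/eqP vS /eqP wS]; apply/setP => x; rewrite inE.
  apply/imsetP/idP => [[y Sy /merge_inj[-> //|[]]]|Sx]; last by exists x.
  by move: Sy; rewrite endsE !inE => + /orP[]/eqP-> /orP[]/eqP Ey;
    rewrite Ey ?vS ?wS.
apply: eq_bigl => S; rewrite !inE mv mw andbb; apply/esym/andb_idr => _.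
apply/eqP/setP => a; apply/imsetP/idP => [[x]|Sa]; first by rewrite inE => Sx ->.
by have [x xa] := merge_surj a; exists x; rewrite ?inE xa.
Qed.

End FaceNumbers.

Theorem theorem4p11 (R : realType) (Sigma : topologicalType) (G : mgraph)
    (sigma : realization R G -> Sigma) (e : edge G) (v w : vert G)
    (sigma' : realization R (contract_graph e) -> Sigma) :
  surface R Sigma -> connected [set: Sigma]%classic ->
  topological_embedding sigma ->
  joins e v w -> v != w ->
  contracted_embedding sigma sigma' ->
  beta sigma =
    'X * beta sigma'
    + beta (restrict_embedding sigma (~: [set v])%SET)
    + beta (restrict_embedding sigma (~: [set w])%SET)
    - (1 + 'X) * beta (restrict_embedding sigma (~: [set v; w])%SET).
Proof.
move=> [hS _ _] _ _ jvw vw hc.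
have ne : src e != tgt e.
  by case/orP: jvw => /andP[/eqP-> /eqP->] //; rewrite eq_sym.
pose F (S : {set vert G}) : {poly int} :=
  (face_number sigma S)%:R *: 'X^(#|S|.-1).
(* With the merged vertex, the preimage has one vertex more and this absorbs the factor ['X];
   without it, cardinalities agree and the factor stays. *)
have contractE : 'X * beta sigma' =
    \sum_(S : {set vert G} | (v \in S) && (w \in S)) F S +
    'X * \sum_(S : {set vert G} | (v \notin S) && (w \notin S)) F S.
  rewrite betaE (bigID (fun S : {set vert (contract_graph e)} => None \in S)) /=.
  rewrite mulrDr; congr (_ + 'X * _).
    under [RHS]eq_bigl do rewrite -(eqb_id (v \in _)) -(eqb_id (w \in _)).
    rewrite -(big_merge_preimage true F jvw) mulr_sumr.
    apply: eq_big => [S|S NS]; first by rewrite eqb_id.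
    rewrite /F (face_number_contract S hS hc) card_merge_preimage // NS addn1 /=.
    (* Raising the exponent [#|S|.-1] by one gives [#|S|] only for nonempty [S]; [None] is a
       witness. *)
    rewrite -scalerAr -exprS prednK // card_gt0.
    by apply/set0Pn; exists None.
  under [RHS]eq_bigl do rewrite -!eqbF_neg.
  rewrite -(big_merge_preimage false F jvw).
  apply: eq_big => [S|S NS]; first by rewrite eqbF_neg.
  rewrite /F (face_number_contract S hS hc) card_merge_preimage //.
  by rewrite (negPf NS) addn0.
have notin1 x : \sum_(S : {set vert G} | S \subset (~: [set x])%SET) F S =
    \sum_(S : {set vert G} | x \notin S) F S.
  by apply: eq_bigl => S; rewrite finset.subsetC finset.sub1set finset.in_setC.
have notin2 : \sum_(S : {set vert G} | S \subset (~: [set v; w])%SET) F S =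
    \sum_(S : {set vert G} | (v \notin S) && (w \notin S)) F S.
  apply: eq_bigl => S.
  by rewrite finset.subsetC finset.subUset !finset.sub1set !finset.in_setC.
have notin_w : \sum_(S : {set vert G} | w \notin S) F S =
    \sum_(S : {set vert G} | (v \in S) && (w \notin S)) F S +
    \sum_(S : {set vert G} | (v \notin S) && (w \notin S)) F S.
  rewrite (bigID (fun S : {set vert G} => v \in S)) /=.
  by congr (_ + _); apply: eq_bigl => S; rewrite andbC.
(* Let a, b, c, d be the sums over the sets containing both [v] and [w], only [v], only [w],
   neither. The claim becomes a + b + c + d = (a + xd) + (c + d) + (b + d) - (1 + x)d. *)
rewrite contractE betaE !beta_restrict -/F notin2 !notin1 notin_w.
rewrite (bigID (fun S : {set vert G} => v \in S)) /=.
rewrite (bigID (fun S : {set vert G} => w \in S)) /=.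
rewrite (bigID (fun S : {set vert G} => w \in S) (fun S => v \notin S)) /=.
ring.
Qed.
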